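(* Let $d\ge2$ and let $A=\mathrm{Comm}(F_d)$ be the group of abstract commensurators of the free group $F_d$ of rank $d$. Identify $F_d$ with its natural image in $A$. Then: (i) $A$ is almost simple. (ii) $\mathrm{Mon}(A)$ contains a finite index subgroup of $F_d$. (iii) $\mathrm{Mon}(A)$ is not finitely generated.
   Context: For a group $\Gamma$, the group $\mathrm{Comm}(\Gamma)$ of abstract commensurators is the quotient of the set of pairs $(\Gamma_0,\alpha_0)$, with $\Gamma_0\le\Gamma$ of finite index and $\alpha_0\colon\Gamma_0\to\Gamma$ an injective homomorphism with image of finite index, by the equivalence relation identifying $(\Gamma_0,\alpha_0)$ and $(\Gamma_1,\alpha_1)$ when $\alpha_0$ and $\alpha_1$ coincide on a finite index subgroup of $\Gamma_0\cap\Gamma_1$; the group law is induced by composition. The natural map $\Gamma\to\mathrm{Comm}(\Gamma)$ sends $g$ to the class of conjugation by $g$; it is injective for $\Gamma=F_d$, $d\ge2$. A group $G$ is monolithic if the intersection of all its non-identity normal subgroups is non-trivial; that intersection is the monolith $\mathrm{Mon}(G)$. $G$ is almost simple if it is monolithic and its monolith is a non-abelian simple group. *)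

(* Defs.v *)
From HB Require Import structures.
From mathcomp Require Import all_boot generic_quotient.
From mathcomp Require Import mathcomp_extra boolp classical_sets functions cardinality.

Set Implicit Arguments.
Unset Strict Implicit.
Unset Printing Implicit Defensive.

Local Open Scope classical_set_scope.
Local Open Scope group_scope.
Local Open Scope quotient_scope.

(* Subgroups of a possibly infinite group, as classical sets. *)
Section Subgroups.
Variable G : groupType.
Implicit Types (H K N S : set G).

Definition subgroup H : Prop :=
  H 1 /\ (forall x y, H x -> H y -> H (x / y)).

Definition left_coset H (g : G) : set G := [set g * h | h in H].

(* K is a subgroup of H with finitely many cosets g K, g in H. *)
Definition finite_index_in K H : Prop :=
  [/\ subgroup K, K `<=` H & finite_set (left_coset K @` H)].

Definition finite_index K : Prop := finite_index_in K setT.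

Definition normal_in N H : Prop :=
  [/\ subgroup N, N `<=` H & forall n h, N n -> H h -> N (n ^ h)].

Definition simple_subgroup H : Prop :=
  [/\ subgroup H, H <> [set 1]
    & forall N, normal_in N H -> N = [set 1] \/ N = H].

Definition abelian_subgroup H : Prop :=
  forall x y, H x -> H y -> commute x y.

Definition finitely_generated H : Prop :=
  exists2 S, finite_set S & H = smallest subgroup S.

End Subgroups.

Definition monolith (G : groupType) : set G :=
  \bigcap_(N in [set N : set G | normal_in N setT /\ N <> [set 1]]) N.

Arguments monolith : clear implicits.

Definition monolithic (G : groupType) : Prop := monolith G <> [set 1].

Definition almost_simple (G : groupType) : Prop :=
  [/\ monolithic G, simple_subgroup (monolith G)
    & ~ abelian_subgroup (monolith G)].

Section SubgroupTheory.
Variable G : groupType.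
Implicit Types (H K L : set G).

Lemma subgroup1 H : subgroup H -> H 1. Proof. by case. Qed.

Lemma subgroupV H x : subgroup H -> H x -> H x^-1.
Proof. by move=> [H1 Hd] Hx; rewrite -div1g; exact: Hd. Qed.

Lemma subgroupM H x y : subgroup H -> H x -> H y -> H (x * y).
Proof.
move=> sH Hx Hy; rewrite -[y]invgK; apply: (proj2 sH) => //.
exact: subgroupV.
Qed.

Lemma subgroupT : subgroup [set: G]. Proof. by []. Qed.

Lemma subgroupI H K : subgroup H -> subgroup K -> subgroup (H `&` K).
Proof.
move=> [H1 Hd] [K1 Kd]; split=> // x y [Hx Kx] [Hy Ky].
by split; [exact: Hd|exact: Kd].
Qed.

Lemma left_coset_eq K x y : subgroup K ->
  K (x^-1 * y) -> left_coset K x = left_coset K y.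
Proof.
move=> sK Kxy; apply/seteqP; split=> _ [k Kk <-].
  exists (y^-1 * x * k); last by rewrite !mulgA mulgV mul1g.
  apply: subgroupM => //; have := subgroupV sK Kxy.
  by rewrite invgM invgK.
exists (x^-1 * y * k); last by rewrite !mulgA mulgV mul1g.
exact: subgroupM.
Qed.

Lemma pick_reps (I : eqType) (s : seq I) (P : I -> G -> Prop) H :
  exists2 r : seq G, (forall x, x \in r -> H x) &
    forall i h, i \in s -> H h -> P i h ->
      exists2 u, u \in r & P i u.
Proof.
elim: s => [|i s [r rH rP]]; first by exists [::].
have [[u Hu Pu]|nP] := pselect (exists2 u, H u & P i u).
- exists (u :: r) => [x|j h].
    by rewrite inE => /orP[/eqP->//|/rH].
  rewrite inE => /orP[/eqP-> _ _|js Hh Ph]; first by exists u; rewrite ?mem_head.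
  by have [v vr Pv] := rP j h js Hh Ph; exists v; rewrite // inE vr orbT.
- exists r => // j h; rewrite inE => /orP[/eqP-> Hh Ph|]; last exact: rP.
  by case: nP; exists h.
Qed.

Lemma finite_index_cover K H : finite_index_in K H ->
  exists2 r : seq G, (forall x, x \in r -> H x) &
    forall h, H h -> exists2 t, t \in r & K (t^-1 * h).
Proof.
move=> [sK KH /finite_seqP[s es]].
have [r rH rP] := pick_reps s (fun C x => C = left_coset K x) H.
exists r => // h Hh.
have hs : left_coset K h \in s.
  have : (left_coset K @` H) (left_coset K h) by exists h.
  by rewrite es.
have [u ur e] := rP _ h hs Hh erefl.
exists u => //; have : left_coset K h h.
  by exists 1; rewrite ?mulg1; [exact: subgroup1|].
by rewrite e => -[k Kk <-]; rewrite mulgA mulVg mul1g.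
Qed.

Lemma cover_finite_index K H (r : seq G) : subgroup K -> K `<=` H ->
  (forall h, H h -> exists2 t, t \in r & K (t^-1 * h)) -> finite_index_in K H.
Proof.
move=> sK KH rP; split=> //.
apply: (@sub_finite_set _ _ (left_coset K @` [set` r])).
  move=> _ [h Hh <-]; have [t tr Kt] := rP h Hh.
  by exists t => //; exact: left_coset_eq.
exact/finite_image/finite_seq.
Qed.

Lemma finite_index_trans L K H :
  finite_index_in L K -> finite_index_in K H -> finite_index_in L H.
Proof.
move=> fL fK.
have [s sK sP] := finite_index_cover fL; have [r rH rP] := finite_index_cover fK.
case: fL fK => sL LK _ [_ KH _].
apply: (@cover_finite_index _ _ [seq t * u | t <- r, u <- s]) => //.
  exact: subset_trans KH.
move=> h /rP[t tr Kt]; have [u us Lu] := sP _ Kt.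
exists (t * u); first exact: allpairs_f.
by rewrite invgM -mulgA.
Qed.

Lemma finite_indexT : finite_index [set: G].
Proof.
apply: (@cover_finite_index _ _ [:: 1]) => // h _.
by exists 1; rewrite ?mem_head.
Qed.

Lemma finite_index_sub L K H : subgroup K ->
  L `<=` K -> K `<=` H -> finite_index_in L H -> finite_index_in K H.
Proof.
move=> sK LK KH /finite_index_cover[r rH rP].
apply: (@cover_finite_index _ _ r) => // h /rP[t tr Lt].
by exists t => //; exact: LK.
Qed.

Lemma finite_index_subr L K H :
  K `<=` H -> L `<=` K -> finite_index_in L H -> finite_index_in L K.
Proof.
move=> KH LK [sL _ fL]; split=> //; apply: sub_finite_set fL.
exact: image_subset.
Qed.

End SubgroupTheory.

Section SubgroupMorphism.
Variables (G G' : groupType) (H : set G) (f : G -> G').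
Hypothesis sH : subgroup H.
Hypothesis fM : forall x y, H x -> H y -> f (x * y) = f x * f y.

Lemma locmorph1 : f 1 = 1.
Proof.
apply: (@mulgI G' (f 1)); rewrite mulg1 -fM ?mulg1 //; exact: subgroup1.
Qed.

Lemma locmorphV x : H x -> f x^-1 = (f x)^-1.
Proof.
move=> Hx; apply: (@mulgI G' (f x)).
by rewrite -fM ?mulgV ?locmorph1 //; exact: subgroupV.
Qed.

Lemma subgroup_image K : subgroup K -> K `<=` H -> subgroup (f @` K).
Proof.
move=> sK KH; split; first by exists 1; [exact: subgroup1|exact: locmorph1].
move=> _ _ [x Kx <-] [y Ky <-]; exists (x / y); first exact: (proj2 sK).
have Ky' := subgroupV sK Ky.
by rewrite fM ?locmorphV //; exact: KH.
Qed.

Lemma subgroup_preimage K : subgroup K -> subgroup (H `&` f @^-1` K).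
Proof.
move=> sK; split.
  by split; [exact: subgroup1|rewrite /= locmorph1; exact: subgroup1].
move=> x y [Hx Kx] [Hy Ky]; split; first exact: (proj2 sH).
rewrite /= fM ?locmorphV //; last exact: subgroupV.
exact: (proj2 sK).
Qed.

Lemma finite_index_preimage K :
  finite_index K -> finite_index_in (H `&` f @^-1` K) H.
Proof.
move=> fK; have [s _ sP] := finite_index_cover fK.
have sK : subgroup K by case: fK.
have [r rH rP] := pick_reps s (fun t x => K (t^-1 * f x)) H.
apply: (@cover_finite_index _ _ _ r).
- exact: subgroup_preimage.
- exact: subIsetl.
- move=> h Hh; have [t ts Kt] := sP (f h) I.
  have [u ur Ku] := rP t h ts Hh Kt.
  have Hu := rH u ur; have Hu' := subgroupV sH Hu.
  exists u => //; split; first exact: subgroupM.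
  rewrite /= fM // locmorphV // -[f h](mulVKg t) mulgA.
  apply: subgroupM => //.
  by have := subgroupV sK Ku; rewrite invgM invgK.
Qed.

Lemma finite_index_image K :
  finite_index_in K H -> finite_index_in (f @` K) (f @` H).
Proof.
move=> fK; have [r rH rP] := finite_index_cover fK; case: fK => sK KH _.
apply: (@cover_finite_index _ _ _ (map f r)).
- exact: subgroup_image.
- exact: image_subset.
- move=> _ [h Hh <-]; have [t tr Kt] := rP h Hh.
  exists (f t); first exact: map_f.
  exists (t^-1 * h) => //; have Ht := rH t tr.
  by rewrite fM ?locmorphV //; exact: subgroupV.
Qed.

End SubgroupMorphism.

Section Commensurator.
Variable G : groupType.

(* The homomorphism cp_dom -> G is a total function on G; its values outside *)
(* cp_dom are junk, which comm_equiv ignores.                                *)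
Record comm_pair := CommPair {
  cp_dom : set G;
  cp_fun :> G -> G;
  cp_dom_finite_index : finite_index cp_dom;
  cp_morph : forall x y, cp_dom x -> cp_dom y ->
    cp_fun (x * y) = cp_fun x * cp_fun y;
  cp_inj : set_inj cp_dom cp_fun;
  cp_im_finite_index : finite_index (cp_fun @` cp_dom) }.

HB.instance Definition _ := gen_eqMixin comm_pair.
HB.instance Definition _ := gen_choiceMixin comm_pair.

Implicit Types a b c : comm_pair.

Definition comm_equiv_prop a b : Prop :=
  exists2 K : set G, finite_index_in K (cp_dom a `&` cp_dom b)
    & {in K, a =1 b}.

Lemma cp_subgroup a : subgroup (cp_dom a).
Proof. by case: (cp_dom_finite_index a). Qed.

Lemma cp_injP a x y : cp_dom a x -> cp_dom a y -> a x = a y -> x = y.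
Proof. by move=> ax ay; apply: cp_inj; rewrite inE. Qed.

Lemma finite_indexI (H K : set G) :
  finite_index H -> finite_index K -> finite_index (H `&` K).
Proof.
move=> fH fK; apply: finite_index_trans (fH).
have sH : subgroup H by case: fH.
exact: (@finite_index_preimage _ _ H id sH _ K fK).
Qed.

(* As both domains have finite index, K may be taken of finite index in G. *)
Lemma comm_equivP a b : comm_equiv_prop a b <->
  exists K : set G, [/\ finite_index K, K `<=` cp_dom a, K `<=` cp_dom b
    & forall x, K x -> a x = b x].
Proof.
split=> [[K fK eK]|[K [fK Ka Kb eK]]].
  have [_ KI _] := fK; exists K; split.
  - apply: finite_index_trans fK _.
    exact: finite_indexI (cp_dom_finite_index a) (cp_dom_finite_index b).
  - by move=> x /KI[].
  - by move=> x /KI[].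
  - by move=> x Kx; apply: eK; rewrite inE.
exists K; last by move=> x; rewrite inE => /eK.
by apply: finite_index_subr fK => // x Kx; split; [exact: Ka|exact: Kb].
Qed.

Definition comm_equiv : rel comm_pair := fun a b => `[< comm_equiv_prop a b >].

Lemma comm_equiv_refl : reflexive comm_equiv.
Proof.
move=> a; apply/asboolP/comm_equivP; exists (cp_dom a); split=> //.
exact: cp_dom_finite_index.
Qed.

Lemma comm_equiv_sym : symmetric comm_equiv.
Proof.
suff h a b : comm_equiv a b -> comm_equiv b a by move=> a b; apply/idP/idP => /h.
move=> /asboolP/comm_equivP[K [fK Ka Kb e]].
by apply/asboolP/comm_equivP; exists K; split=> // x /e.
Qed.

Lemma comm_equiv_trans : transitive comm_equiv.
Proof.
move=> b a c /asboolP/comm_equivP[K [fK Ka Kb eK]].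
move=> /asboolP/comm_equivP[L [fL Lb Lc eL]].
apply/asboolP/comm_equivP; exists (K `&` L); split.
- exact: finite_indexI.
- by move=> x [/Ka].
- by move=> x [_ /Lc].
- by move=> x [Kx Lx]; rewrite eK ?eL.
Qed.

Canonical comm_equiv_equiv :=
  EquivRel comm_equiv comm_equiv_refl comm_equiv_sym comm_equiv_trans.

Definition Comm := {eq_quot comm_equiv}.
HB.instance Definition _ := Choice.on Comm.
HB.instance Definition _ := Quotient.on Comm.

Lemma CommP a b : \pi_Comm a = \pi_Comm b <-> comm_equiv_prop a b.
Proof.
split=> [/eqmodP/asboolP//|h].
by apply/eqmodP/asboolP.
Qed.

Section Conj.
Variable g : G.

Let conj (x : G) : G := g * x * g^-1.

Fact conj_morph x y : [set: G] x -> [set: G] y -> conj (x * y) = conj x * conj y.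
Proof. by rewrite /conj !mulgA mulgVK. Qed.

Fact conj_inj : set_inj setT conj.
Proof. by move=> x y _ _ /mulIg/mulgI. Qed.

Fact conj_im : finite_index (conj @` setT).
Proof.
suff -> : conj @` setT = setT by exact: finite_indexT.
apply/seteqP; split=> // x _; exists (g^-1 * x * g) => //.
by rewrite /conj !mulgA mulgV mul1g mulgK.
Qed.

Definition conj_pair : comm_pair :=
  CommPair (finite_indexT G) conj_morph conj_inj conj_im.

End Conj.

Section Comp.
Variables a b : comm_pair.

Let dom : set G := cp_dom b `&` b @^-1` (cp_dom a).
Let f : G -> G := a \o b.

Fact comp_dom : finite_index dom.
Proof.
apply: finite_index_trans (cp_dom_finite_index b).
apply: finite_index_preimage (cp_dom_finite_index a).
  exact: cp_subgroup.
exact: cp_morph.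
Qed.

Fact comp_morph x y : dom x -> dom y -> f (x * y) = f x * f y.
Proof. by move=> [bx ax] [b_y ay]; rewrite /f /= !cp_morph. Qed.

Fact comp_inj : set_inj dom f.
Proof.
move=> x y; rewrite !inE => -[bx ax] [b_y ay] e.
exact: (cp_injP bx b_y (cp_injP ax ay e)).
Qed.

Fact comp_im : finite_index (f @` dom).
Proof.
have -> : f @` dom = a @` (cp_dom a `&` b @` cp_dom b).
  apply/seteqP; split=> [_ [x [bx ax] <-]|_ [y [ay [x bx e]] <-]].
    by exists (b x) => //; split=> //; exists x.
  by subst y; exists x.
apply: finite_index_trans (cp_im_finite_index a).
apply: (@finite_index_image _ _ (cp_dom a) a); [exact: cp_subgroup|exact: cp_morph|].
apply: (@finite_index_subr _ _ _ setT) => //.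
exact: finite_indexI (cp_dom_finite_index a) (cp_im_finite_index b).
Qed.

Definition comp_pair : comm_pair := CommPair comp_dom comp_morph comp_inj comp_im.

End Comp.

Section Inverse.
Variable a : comm_pair.

Let f (y : G) : G := xget 1 [set x | cp_dom a x /\ a x = y].

Lemma inv_funK x : cp_dom a x -> f (a x) = x.
Proof.
move=> ax; apply: xget_unique => // y [ay e].
exact: cp_injP e.
Qed.

Fact inv_morph x y : (a @` cp_dom a) x -> (a @` cp_dom a) y ->
  f (x * y) = f x * f y.
Proof.
move=> [u au <-] [v av <-]; rewrite -cp_morph // !inv_funK //.
exact: subgroupM (cp_subgroup a) _ _.
Qed.

Fact inv_inj : set_inj (a @` cp_dom a) f.
Proof.
by move=> x y; rewrite !inE => -[u au <-] [v av <-]; rewrite !inv_funK // => ->.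
Qed.

Fact inv_im : finite_index (f @` (a @` cp_dom a)).
Proof.
suff -> : f @` (a @` cp_dom a) = cp_dom a by exact: cp_dom_finite_index.
apply/seteqP; split=> [_ [_ [x ax <-] <-]|x ax]; first by rewrite inv_funK.
by exists (a x); [exists x|exact: inv_funK].
Qed.

Definition inv_pair : comm_pair :=
  CommPair (cp_im_finite_index a) inv_morph inv_inj inv_im.

Lemma inv_pairK x : cp_dom a x -> inv_pair (a x) = x.
Proof. exact: inv_funK. Qed.

End Inverse.

Lemma comp_pair_equiv a a' b b' : comm_equiv_prop a a' -> comm_equiv_prop b b' ->
  comm_equiv_prop (comp_pair a b) (comp_pair a' b').
Proof.
move=> /comm_equivP[K [fK Ka Ka' eK]] /comm_equivP[L [fL Lb Lb' eL]].
apply/comm_equivP; exists (L `&` b @^-1` K); split.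
- apply: finite_index_trans (fL); apply: finite_index_preimage (fK).
    by case: fL.
  by move=> x y /Lb bx /Lb; exact: cp_morph.
- by move=> x [/Lb bx /Ka ax].
- move=> x [Lx Kx]; split; first exact: Lb'.
  by rewrite /= -eL //; exact: Ka'.
- by move=> x [Lx Kx]; rewrite /= eK // eL.
Qed.

Lemma inv_pair_equiv a a' : comm_equiv_prop a a' ->
  comm_equiv_prop (inv_pair a) (inv_pair a').
Proof.
move=> /comm_equivP[K [fK Ka Ka' eK]].
apply/comm_equivP; exists (a @` K); split.
- apply: finite_index_trans (cp_im_finite_index a).
  apply: (@finite_index_image _ _ (cp_dom a) a); [exact: cp_subgroup|exact: cp_morph|].
  exact: (@finite_index_subr _ _ _ setT).
- by move=> _ [x /Ka ax <-]; exists x.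
- by move=> _ [x Kx <-]; exists x; [exact: Ka'|rewrite eK].
- move=> _ [x Kx <-]; rewrite inv_pairK; last exact: Ka.
  by rewrite eK // inv_pairK //; exact: Ka'.
Qed.

Definition comm_one : Comm := \pi_Comm (conj_pair 1).
Definition comm_mul (u v : Comm) : Comm := \pi_Comm (comp_pair (repr u) (repr v)).
Definition comm_inv (u : Comm) : Comm := \pi_Comm (inv_pair (repr u)).

Lemma repr_pi a : comm_equiv_prop (repr (\pi_Comm a)) a.
Proof. by apply/CommP; rewrite reprK. Qed.

Lemma comm_mul_pi a b : comm_mul (\pi_Comm a) (\pi_Comm b) = \pi_Comm (comp_pair a b).
Proof. by apply/CommP/comp_pair_equiv; exact: repr_pi. Qed.

Lemma comm_inv_pi a : comm_inv (\pi_Comm a) = \pi_Comm (inv_pair a).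
Proof. by apply/CommP/inv_pair_equiv/repr_pi. Qed.

Fact comm_mulA : associative comm_mul.
Proof.
elim/quotW => a; elim/quotW => b; elim/quotW => c.
rewrite (comm_mul_pi b) (comm_mul_pi a b) (comm_mul_pi a) comm_mul_pi.
apply/CommP/comm_equivP; exists (cp_dom (comp_pair a (comp_pair b c))); split=> //.
  exact: cp_dom_finite_index.
by move=> x /= [[cx bx] ax].
Qed.

Fact comm_mul1g : left_id comm_one comm_mul.
Proof.
elim/quotW => a; rewrite comm_mul_pi.
apply/CommP/comm_equivP; exists (cp_dom a); split=> //.
- exact: cp_dom_finite_index.
- by move=> x _ /=; rewrite mul1g invg1 mulg1.
Qed.

Fact comm_mulg1 : right_id comm_one comm_mul.
Proof.
elim/quotW => a; rewrite comm_mul_pi.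
have e x : 1 * x * 1^-1 = x :> G by rewrite mul1g invg1 mulg1.
apply/CommP/comm_equivP; exists (cp_dom a); split=> //.
- exact: cp_dom_finite_index.
- by move=> x ax; split=> //=; rewrite e.
- by move=> x _ /=; rewrite e.
Qed.

Fact comm_mulVg : left_inverse comm_one comm_inv comm_mul.
Proof.
elim/quotW => a; rewrite comm_inv_pi comm_mul_pi.
apply/CommP/comm_equivP; exists (cp_dom a); split=> //.
- exact: cp_dom_finite_index.
- by move=> x ax; split=> //; exists x.
- by move=> x ax; rewrite [LHS](inv_pairK ax) /= mul1g invg1 mulg1.
Qed.

Fact comm_mulgV : right_inverse comm_one comm_inv comm_mul.
Proof.
elim/quotW => a; rewrite comm_inv_pi comm_mul_pi.
apply/CommP/comm_equivP; exists (a @` cp_dom a); split=> //.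
- exact: cp_im_finite_index.
- move=> _ [x ax <-]; split; first by exists x.
  by change (cp_dom a (inv_pair a (a x))); rewrite inv_pairK.
- move=> _ [x ax <-]; change (a (inv_pair a (a x)) = 1 * a x * 1^-1).
  by rewrite inv_pairK // mul1g invg1 mulg1.
Qed.

HB.instance Definition _ :=
  isGroup.Build Comm comm_mulA comm_mul1g comm_mulg1 comm_mulVg comm_mulgV.

Definition comm_conj (g : G) : Comm := \pi_Comm (conj_pair g).

Fact comm_conjM : {morph comm_conj : x y / x * y}.
Proof.
move=> g h; rewrite /comm_conj [RHS]comm_mul_pi.
apply/CommP/comm_equivP; exists setT; split=> //.
  exact: finite_indexT.
by move=> x _ /=; rewrite invgM !mulgA.
Qed.

HB.instance Definition _ := isMultiplicative.Build G Comm comm_conj comm_conjM.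

End Commensurator.

(* The free group on X, as reduced words; the letter (x, b) is x if b is *)
(* false and x^-1 if b is true.                                          *)
Section FreeGroup.
Variable X : choiceType.

Definition letter : Type := X * bool.
HB.instance Definition _ := Choice.on letter.
Implicit Types (l m : letter) (u v w : seq letter).

Definition linv l : letter := (l.1, ~~ l.2).

Arguments linv : simpl never.

Lemma linvK : involutive linv.
Proof. by case=> x b; rewrite /linv /= negbK. Qed.

Definition reduced : pred (seq letter) := sorted (fun l m => m != linv l).

Record free_group := FreeGroup { fg_word :> seq letter; fg_reduced : reduced fg_word }.
HB.instance Definition _ := [isSub for fg_word].
HB.instance Definition _ := [Choice of free_group by <:].

Definition rcons_word l w : seq letter :=
  if w is m :: w' then if m == linv l then w' else l :: w else [:: l].

Definition rmul u v : seq letter := foldr rcons_word v u.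
Definition rinv u : seq letter := rev (map linv u).

Lemma rcons_reduced l w : reduced w -> reduced (rcons_word l w).
Proof.
case: w => //= m w; case: (boolP (m == _)) => [_|ne] r; last by rewrite /= ne.
exact: path_sorted r.
Qed.

Lemma rcons_wordK l w : reduced w -> rcons_word (linv l) (rcons_word l w) = w.
Proof.
case: w => [|m w] /=; first by rewrite linvK eqxx.
case: (eqVneq m (linv l)) => [-> |ne r] /=; last by rewrite linvK eqxx.
by case: w => //= m' w /andP[/negbTE ->].
Qed.

Lemma rmul_reduced u v : reduced v -> reduced (rmul u v).
Proof. by move=> rv; elim: u => //= l u; exact: rcons_reduced. Qed.

Lemma rmul_rcons l u w : reduced w -> rmul (rcons_word l u) w = rcons_word l (rmul u w).
Proof.
case: u => //= m u rw; case: eqP => //= ->.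
by rewrite -{1}[l]linvK rcons_wordK //; exact: rmul_reduced.
Qed.

Lemma rmulA u v w : reduced w -> rmul u (rmul v w) = rmul (rmul u v) w.
Proof. by move=> rw; elim: u => //= l u ->; rewrite rmul_rcons. Qed.

Lemma rmul1 u : reduced u -> rmul u [::] = u.
Proof.
elim: u => //= l u IH r; rewrite IH; last exact: path_sorted r.
by case: u r {IH} => //= m u /andP[/negbTE ->].
Qed.

Lemma rmul_cat u v w : rmul (u ++ v) w = rmul u (rmul v w).
Proof. exact: foldr_cat. Qed.

Lemma rmulV u w : reduced w -> rmul (rinv u) (rmul u w) = w.
Proof.
move=> rw; elim: u => //= l u IH.
rewrite /rinv /= rev_cons -cats1 rmul_cat /= rcons_wordK //.
exact: rmul_reduced.
Qed.

Lemma rinv_reduced u : reduced u -> reduced (rinv u).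
Proof.
rewrite /reduced /rinv rev_sorted sorted_map; apply: sub_sorted => l m /= ne.
by apply: contra ne => /eqP e; rewrite -[m]linvK -e eqxx.
Qed.

Lemma rinvK u : rinv (rinv u) = u.
Proof. by rewrite /rinv map_rev revK mapK //; exact: linvK. Qed.

Definition fg_one : free_group := @FreeGroup [::] isT.
Definition fg_mul (u v : free_group) : free_group :=
  FreeGroup (rmul_reduced u (fg_reduced v)).
Definition fg_inv (u : free_group) : free_group :=
  FreeGroup (rinv_reduced (fg_reduced u)).

Fact fg_mulA : associative fg_mul.
Proof. by move=> u v w; apply: val_inj; exact: rmulA (fg_reduced w). Qed.
Fact fg_mul1g : left_id fg_one fg_mul.
Proof. by move=> u; exact: val_inj. Qed.
Fact fg_mulg1 : right_id fg_one fg_mul.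
Proof. by move=> u; apply: val_inj; exact: rmul1 (fg_reduced u). Qed.
Fact fg_mulVg : left_inverse fg_one fg_inv fg_mul.
Proof.
move=> u; apply: val_inj; rewrite /= -{2}[fg_word u]rmul1 ?fg_reduced //.
exact: rmulV.
Qed.
Fact fg_mulgV : right_inverse fg_one fg_inv fg_mul.
Proof.
move=> u; have e : fg_inv (fg_inv u) = u by apply: val_inj; exact: rinvK.
by rewrite -{1}e fg_mulVg.
Qed.

HB.instance Definition _ :=
  isGroup.Build free_group fg_mulA fg_mul1g fg_mulg1 fg_mulVg fg_mulgV.

Definition fg_gen (x : X) : free_group := @FreeGroup [:: (x, false)] isT.

Section Universal.
Variables (G : groupType) (f : X -> G).

Definition letter_val l : G := if l.2 then (f l.1)^-1 else f l.1.

Definition fg_eval (u : free_group) : G :=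
  foldr (fun l g => letter_val l * g) 1 (fg_word u).

Let ev (u : seq letter) : G := foldr (fun l g => letter_val l * g) 1 u.

Lemma letter_valV l : letter_val (linv l) = (letter_val l)^-1.
Proof. by case: l => x []; rewrite /letter_val /= ?invgK. Qed.

Fact fg_evalM : {morph fg_eval : u v / u * v}.
Proof.
have evr l u : ev (rcons_word l u) = letter_val l * ev u.
  case: u => //= m u; case: eqP => //= ->.
  by rewrite letter_valV mulgA mulgV mul1g.
move=> [u ru] [v rv]; rewrite /fg_eval /= -!/(ev _) {ru rv}.
by elim: u => /= [|l u IH]; rewrite ?mul1g // evr IH mulgA.
Qed.

HB.instance Definition _ := isMultiplicative.Build free_group G fg_eval fg_evalM.

Lemma fg_eval_gen x : fg_eval (fg_gen x) = f x.
Proof. exact: mulg1. Qed.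

End Universal.

Lemma fg_eval_unique (G : groupType) (f : X -> G) (h : free_group -> G) :
  {morph h : u v / u * v} -> (forall x, h (fg_gen x) = f x) -> h =1 fg_eval f.
Proof.
move=> hM hf.
have h1 : h 1 = 1.
  by apply: (@mulgI G (h 1)); rewrite -hM !mulg1.
have hl l : h (@FreeGroup [:: l] isT) = letter_val f l.
  case: l => x []; last exact: hf.
  rewrite /letter_val /= -hf; apply: (@mulgI G (h (fg_gen x))).
  rewrite mulgV -hM -[RHS]h1; congr h; apply: val_inj => /=.
  by rewrite eqxx.
case=> u; elim: u => [|l u IH] ru; first by rewrite -[RHS]h1; congr h; apply: val_inj.
have ru' : reduced u by exact: path_sorted ru.
have -> : fg_eval f (FreeGroup ru) = letter_val f l * fg_eval f (FreeGroup ru') by [].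
rewrite -IH -hl -hM.
congr h; apply: val_inj => /=.
by case: u ru {IH ru'} => //= m u /andP[/negbTE ->].
Qed.

End FreeGroup.

(* Main.v *)
From HB Require Import structures.
Require Import Defs.
From mathcomp Require Import all_boot.
From mathcomp Require Import perm zmodp generic_quotient.
From mathcomp Require Import boolp classical_sets functions cardinality.

Local Open Scope classical_set_scope.
Set Implicit Arguments.
Unset Strict Implicit.
Unset Printing Implicit Defensive.

Local Open Scope group_scope.
Local Open Scope quotient_scope.

(** Write [F] for the free group, [A] for its commensurator, and identify [F]
    with its image in [A]. Conjugation by the class of a commensuration [a]
    sends each [g] in the domain of [a] to [a g].

    The source of elements of [A] is Marshall Hall's theorem with control of
    the index. A nontrivial [g] is conjugate to the label of a closed path
    without backtracking; reading it twice around a cycle with [n] vertices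
    and completing this cycle to a covering of degree [n] of the rose gives a
    subgroup of index [n] having [g ^+ 2], up to conjugation and inversion, in
    a free basis ([square_basis]). For the label [x_i ^+ n] the covering can be
    written down, and its group has both [x_j] and its conjugate by [x_i] in a
    basis that contains [x_i ^+ n] ([power_basis]). All these bases have the
    same size for a given [n], and a bijection between bases of two subgroups
    of finite index is a commensuration.

    Let now [M] be a normal subgroup of [A] containing [F]. If two members of
    one basis are conjugate in [F], then transporting the conjugating element
    by commensurations shows that in every basis of that size any two members
    are conjugate under [M] ([basis_conjugation]). Consequently [x_i ^+ k] is
    conjugate to [x_j] under [M] for [i <> j] and [k >= 2]
    ([power_conj_gen]), and a normal
    subgroup [S] of [M] that meets [F] nontrivially contains a whole basis of
    a subgroup of finite index, hence some power of each [x_i], hence each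
    [x_j], hence [F] ([normal_contains_free]). Moreover every nontrivial normal
    subgroup of [M] does meet [F] ([normal_meets_free]). With [M = A] this puts
    [F] inside the monolith. With [M] the monolith, it shows that a nontrivial
    normal subgroup [N] of the monolith contains [F]; as this also holds for
    the conjugates of [N] in [A], their intersection is a nontrivial normal
    subgroup of [A], and [N] is the whole monolith.

    For infinite generation, fix a prime [p]. The elements [a] of [A] such
    that [a] and its inverse both conjugate, for each [x] in [F], some power
    [x ^+ N] with [N] prime to [p] into [F] form a subgroup. A finite set lies
    in this subgroup as soon as [p] exceeds the indices of the domains
    involved. But the monolith conjugates [x_i ^+ p] to [x_j], and [x_j ^+ N]
    has a [p]-th root in [F] only when [p] divides [N]. *)

(** * Extending partial injections *)

(** Starting from any bijection, composing with a transposition of the target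
    corrects one value without disturbing those already prescribed. *)
Lemma partial_bijection (K T T' : finType) (A : {set K}) (s : K -> T)
    (t : K -> T') :
  #|T| = #|T'| -> {in A &, injective s} -> {in A &, injective t} ->
  exists2 g : T -> T', bijective g & {in A, forall k, g (s k) = t k}.
Proof.
move=> eT; have [m] := ubnP #|A|; elim: m A => // m IH A Am sI tI.
have [->|/set0Pn[k kA]] := eqVneq A finset.set0.
  exists (fun x => enum_val (cast_ord eT (enum_rank x))) => [|k]; last by rewrite inE.
  exists (fun y => enum_val (cast_ord (esym eT) (enum_rank y))) => x;
    by rewrite enum_valK ?cast_ordK ?cast_ordKV enum_rankK.
have sub l : l \in (A :\ k)%SET -> l \in A by rewrite inE => /andP[].
have [|||g gb gP] := IH (A :\ k)%SET.
- by rewrite (cardsD1 k A) kA in Am.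
- by move=> x y /sub xA /sub yA; exact: sI.
- by move=> x y /sub xA /sub yA; exact: tI.
exists (tperm (g (s k)) (t k) \o g).
  exact: bij_comp (injF_bij perm_inj) gb.
move=> l lA /=; have [->|lk] := eqVneq l k; first by rewrite tpermL.
have lA' : l \in (A :\ k)%SET by rewrite inE inE lk.
rewrite (gP l lA') tpermD //.
- rewrite -(gP l lA') (inj_eq (bij_inj gb)).
  by apply: contra lk => /eqP e; rewrite (sI _ _ kA lA e).
- by apply: contra lk => /eqP e; rewrite (tI _ _ kA lA e).
Qed.

(** * Schreier bases *)

Section Wreath.
Variables (V : finType) (G : groupType).

(** The wreath product of [G] by the permutations of [V]: a homomorphism from
    a group to it is an action on [V] together with a [G]-valued cocycle. *)
Definition wreath : Type := {perm V} * {ffun V -> G}.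
HB.instance Definition _ := Choice.on wreath.
Implicit Types a b c : wreath.

Definition wmul a b : wreath :=
  (a.1 * b.1, [ffun v => a.2 v * b.2 (a.1 v)]).
Definition wone : wreath := (1, [ffun=> 1]).
Definition winv a : wreath := (a.1^-1, [ffun v => (a.2 (a.1^-1%g v))^-1]).

Fact wmulA : associative wmul.
Proof.
move=> a b c; congr (_, _); rewrite /= ?mulgA //.
by apply/ffunP => v; rewrite !ffunE /= permM mulgA.
Qed.
Fact wmul1g : left_id wone wmul.
Proof.
case=> p f; congr (_, _); rewrite /= ?mul1g //.
by apply/ffunP => v; rewrite !ffunE /= perm1 mul1g.
Qed.
Fact wmulg1 : right_id wone wmul.
Proof.
case=> p f; congr (_, _); rewrite /= ?mulg1 //.
by apply/ffunP => v; rewrite !ffunE /= mulg1.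
Qed.
Fact wmulVg : left_inverse wone winv wmul.
Proof.
case=> p f; congr (_, _); rewrite /= ?mulVg //.
by apply/ffunP => v; rewrite !ffunE /= mulVg.
Qed.
Fact wmulgV : right_inverse wone winv wmul.
Proof.
case=> p f; congr (_, _); rewrite /= ?mulgV //.
by apply/ffunP => v; rewrite !ffunE /= permK mulgV.
Qed.

HB.instance Definition _ :=
  isGroup.Build wreath wmulA wmul1g wmulg1 wmulVg wmulgV.

End Wreath.

HB.instance Definition _ (X : choiceType) (G : groupType) (f : X -> G) :=
  Multiplicative_isUMagmaMorphism.Build (free_group X) G (fg_eval f) erefl.

Definition stabilizer (V : finType) (X : choiceType) (pi : X -> {perm V})
  (o : V) : set (free_group X) := [set g | fg_eval pi g o = o].

Definition free_basis (X Y : choiceType) (b : Y -> free_group X)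
    (H : set (free_group X)) : Prop :=
  [/\ injective (fg_eval b), (forall u, H (fg_eval b u))
    & forall h, H h -> exists u, fg_eval b u = h].

Lemma fg_eval_comp (X : choiceType) (G G' : groupType) (f : X -> G)
    (h : G -> G') : {morph h : x y / x * y} ->
  h \o fg_eval f =1 fg_eval (h \o f).
Proof.
move=> hM; apply: fg_eval_unique => [u v|x] /=.
  by rewrite gmulfM hM.
by rewrite fg_eval_gen.
Qed.

Lemma fg_eval_id (X : choiceType) (u : free_group X) :
  fg_eval (@fg_gen X) u = u.
Proof. by symmetry; exact: (@fg_eval_unique _ _ _ id). Qed.

Lemma fg_eval_in (X : choiceType) (G : groupType) (f : X -> G) (S : set G) :
  subgroup S -> (forall x, S (f x)) -> forall u, S (fg_eval f u).
Proof.
move=> sS Sf [u ru]; rewrite /fg_eval /= {ru}.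
elim: u => [|[x b] u IH] /=; first exact: subgroup1.
apply: subgroupM => //; rewrite /letter_val /=; case: b; last exact: Sf.
exact: subgroupV (Sf x).
Qed.

Section Schreier.
(** The Schreier graph of the action [pi] has an edge [(v, x)] from [v] to
    [pi x v]; [t v] is the label of the path in the tree from [o] to [v]. *)
Variables (V X : finType) (pi : X -> {perm V}) (o : V) (tree : {set V * X}).
Variable t : V -> free_group X.

Let act (g : free_group X) (v : V) : V := fg_eval pi g v.

(** The edges of the Schreier graph outside of the tree. *)
Definition nontree := {p : V * X | p \notin tree}.

Definition schreier (y : nontree) : free_group X :=
  t (val y).1 * fg_gen (val y).2 * (t (pi (val y).2 (val y).1))^-1.

Definition edge_label (v : V) (x : X) : free_group nontree :=
  if insub (v, x) is Some y then fg_gen y else 1.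

(** Reidemeister-Schreier rewriting: [cocycle v g] is the product of the
    edges outside of the tree crossed by the path from [v] with label [g]. *)
Definition rewriting (g : free_group X) : wreath V (free_group nontree) :=
  fg_eval (fun x => (pi x, [ffun v => edge_label v x]) : wreath V _) g.
Definition cocycle v g : free_group nontree := (rewriting g).2 v.

Lemma rewriting1 g : (rewriting g).1 = fg_eval pi g.
Proof.
pose h (w : wreath V (free_group nontree)) : {perm V} := w.1.
exact: (@fg_eval_comp _ _ _ _ h).
Qed.

Lemma cocycleM v g h : cocycle v (g * h) = cocycle v g * cocycle (act g v) h.
Proof. by rewrite /cocycle /act -rewriting1 /rewriting gmulfM /= ffunE. Qed.

Lemma cocycle1 v : cocycle v 1 = 1.
Proof. by rewrite /cocycle /rewriting gmulf1 /= ffunE. Qed.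

Lemma actM v g h : act (g * h) v = act h (act g v).
Proof. by rewrite /act gmulfM permM. Qed.

Lemma act_gen v x : act (fg_gen x) v = pi x v.
Proof. by rewrite /act fg_eval_gen. Qed.

Lemma act1 v : act 1 v = v.
Proof. by rewrite /act gmulf1 perm1. Qed.

Lemma actVK v g : act g^-1 (act g v) = v.
Proof. by rewrite -actM mulgV act1. Qed.

Lemma actKV v g : act g (act g^-1 v) = v.
Proof. by rewrite -actM mulVg act1. Qed.

Lemma cocycleV v g : cocycle v g^-1 = (cocycle (act g^-1 v) g)^-1.
Proof.
apply: (@mulIg _ (cocycle (act g^-1 v) g)).
by rewrite mulVg -cocycleM mulVg cocycle1.
Qed.

Lemma cocycle_gen v x : cocycle v (fg_gen x) = edge_label v x.
Proof. by rewrite /cocycle /rewriting fg_eval_gen ffunE. Qed.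

Lemma edge_label_tree v x : (v, x) \in tree -> edge_label v x = 1.
Proof. by move=> vx; rewrite /edge_label insubN // negbK. Qed.

Hypothesis t_root : t o = 1.
Hypothesis act_t : forall v, act (t v) o = v.
Hypothesis cocycle_t : forall v, cocycle o (t v) = 1.
Hypothesis t_tree :
  forall v x, (v, x) \in tree -> t (pi x v) = t v * fg_gen x.

(** Crossing an edge of the tree contributes nothing on either side, so the
    transversal telescopes along the path. *)
Lemma schreier_cocycle v g :
  fg_eval schreier (cocycle v g) = t v * g * (t (act g v))^-1.
Proof.
pose S := [set g | forall v, fg_eval schreier (cocycle v g) = t v * g * (t (act g v))^-1].
have sS : subgroup S.
  split=> [u|x y]; first by rewrite cocycle1 gmulf1 act1 mulg1 mulgV.
  move=> IHx IHy u; rewrite cocycleM cocycleV gmulfM gmulfV /= IHx IHy actM.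
  by rewrite !invgM invgK actKV -!mulgA mulKg.
suff: S g by exact.
rewrite -(fg_eval_id g); apply: fg_eval_in sS _ _ => x {}v /=.
rewrite cocycle_gen act_gen.
have [vx|vx] := boolP ((v, x) \in tree).
  by rewrite edge_label_tree // t_tree // gmulf1 mulgV.
by rewrite /edge_label insubT fg_eval_gen.
Qed.

Lemma subgroup_stabilizer : subgroup (stabilizer pi o).
Proof.
split=> [|g h go ho]; first exact: act1.
rewrite /stabilizer /= -/(act _ _) actM [act g o]go.
by rewrite -[in LHS]ho actVK.
Qed.

Lemma finite_index_stabilizer : finite_index (stabilizer pi o).
Proof.
apply: (@cover_finite_index _ _ _ [seq (t v)^-1 | v <- enum V]) => //.
  exact: subgroup_stabilizer.
move=> g _; exists (t (act g^-1 o))^-1.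
  by apply: map_f; rewrite mem_enum.
by rewrite /stabilizer /= -/(act _ _) invgK actM act_t actKV.
Qed.

(** Rewriting from the root is inverse to evaluation at the Schreier
    generators: it maps the generator of an edge to that edge, because the
    paths of the tree have trivial cocycle. *)
Theorem schreier_basis : free_basis schreier (stabilizer pi o).
Proof.
have st u : stabilizer pi o (fg_eval schreier u).
  apply: fg_eval_in => [|y]; first exact: subgroup_stabilizer.
  rewrite /stabilizer /= -/(act _ _) /schreier !actM act_t act_gen.
  by set v := pi _ _; rewrite -[X in act _ X](act_t v) actVK.
split=> // [u v e|h ho]; last first.
  exists (cocycle o h); rewrite schreier_cocycle [act h o]ho.
  by rewrite t_root mul1g invg1 mulg1.
suff K : cancel (fg_eval schreier) (cocycle o) by rewrite -(K u) e K.
move=> {e v}u; rewrite -[RHS]fg_eval_id.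
apply: (@fg_eval_unique _ _ _ (cocycle o \o fg_eval schreier)) => [{}u v|y] /=.
  by rewrite gmulfM cocycleM [act _ o](st u).
rewrite fg_eval_gen /schreier !cocycleM cocycle_t mul1g act_t cocycle_gen.
rewrite actM act_t act_gen cocycleV.
set v := pi _ _; rewrite -[X in act _ X](act_t v) actVK cocycle_t invg1 mulg1.
rewrite /edge_label -surjective_pairing.
by case: insubP => [z _ /val_inj->//|]; rewrite (valP y).
Qed.

End Schreier.

(** * Bases containing the label of a cycle *)

Section Cycle.
(** [l k] is the label of the edge of an oriented cycle from the vertex [k] to
    [k.+1] modulo [n]. Indexing labels by [nat] allows [l] to have a proper
    divisor of [n] as period, hence the cycle to read a proper power. *)
Variables (X : finType) (m : nat).
Let n := m.+1.
Variable l : nat -> letter X.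
Hypothesis l_periodic : forall k, l (k + n) = l k.
Hypothesis l_reduced : forall k, l k.+1 != linv (l k).

(** The endpoints of the [k]-th edge, once it is oriented so that its label is
    a generator and not the inverse of one. *)
Definition src (k : 'I_n) : 'I_n := if (l k).2 then ordS k else k.
Definition tgt (k : 'I_n) : 'I_n := if (l k).2 then k else ordS k.

Lemma l_ordS (k : 'I_n) : l (ordS k) = l k.+1.
Proof.
rewrite /=; have := ltn_ord k; rewrite leq_eqVlt => /orP[/eqP e|lt].
  by rewrite e modnn -(l_periodic 0).
by rewrite modn_small.
Qed.

Lemma no_backtrack (j k : 'I_n) : (l j).1 = (l k).1 -> (l j).2 -> ~~ (l k).2 ->
  ordS j <> k /\ j <> ordS k.
Proof.
move=> e1 e2 /negbTE e3; split=> e.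
  have /eqP[] := l_reduced j; rewrite -l_ordS e.
  by apply: injective_projections; rewrite /linv /= ?e2.
have /eqP[] := l_reduced k; rewrite -l_ordS -e.
by apply: injective_projections; rewrite /linv /= ?e3.
Qed.

(** Distinct edges with the same generator as label and a common origin
    can only be consecutive on the cycle, which would backtrack there;
    likewise for a common end. *)
Lemma src_inj x : {in [set k : 'I_n | (l k).1 == x]%SET &, injective src}.
Proof.
move=> j k; rewrite !inE => /eqP ej /eqP ek; rewrite /src.
have e : (l j).1 = (l k).1 by rewrite ek.
case: (boolP (l j).2) => bj; case: (boolP (l k).2) => bk.
- exact: ordS_inj.
- by have [] := no_backtrack e bj bk.
- by move/esym => E; have [/(_ E)] := no_backtrack (esym e) bk bj.
- by [].
Qed.

Lemma tgt_inj x : {in [set k : 'I_n | (l k).1 == x]%SET &, injective tgt}.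
Proof.
move=> j k; rewrite !inE => /eqP ej /eqP ek; rewrite /tgt.
have e : (l j).1 = (l k).1 by rewrite ek.
case: (boolP (l j).2) => bj; case: (boolP (l k).2) => bk.
- by [].
- by have [] := no_backtrack e bj bk.
- by move/esym => E; have [_ /(_ E)] := no_backtrack (esym e) bk bj.
- exact: ordS_inj.
Qed.

(** Marshall Hall's argument: a finite graph without folds embeds in a
    covering of the rose with the same vertices. *)
Lemma cycle_completion :
  exists pi : X -> {perm 'I_n}, forall k : 'I_n, pi (l k).1 (src k) = tgt k.
Proof.
have h x : exists p : {perm 'I_n}, forall k : 'I_n, (l k).1 = x -> p (src k) = tgt k.
  have [g gb gP] := partial_bijection erefl (@src_inj x) (@tgt_inj x).
  by exists (perm (bij_inj gb)) => k e; rewrite permE gP // inE e.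
by have [pi piP] := choice h; exists pi => k; exact: piP.
Qed.

Fixpoint prefix (k : nat) : free_group X :=
  if k is k'.+1 then prefix k' * letter_val (@fg_gen X) (l k') else 1.

Definition edge (k : 'I_n) : 'I_n * X := (src k, (l k).1).
(** A spanning tree of the Schreier graph: the path along the cycle. *)
Definition cycle_tree : {set 'I_n * X} := [set edge k | k in [set~ ord_max]]%SET.

Lemma edge_inj : injective edge.
Proof.
move=> j k [es e]; apply: (@src_inj (l k).1) => //; by rewrite inE ?e.
Qed.

Lemma edge_max : edge ord_max \notin cycle_tree.
Proof.
by apply/imsetP => -[k kn /edge_inj e]; rewrite inE -e inE eqxx in kn.
Qed.

Lemma card_nontree : #|{: nontree cycle_tree}| = n * #|X| - m.
Proof.
rewrite card_sig -[RHS]/(n * #|X| - n.-1)%N.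
have <- : #|cycle_tree| = n.-1.
  by rewrite card_imset ?cardsC1 ?card_ord //; exact: edge_inj.
have := cardC (mem cycle_tree); rewrite card_prod card_ord => <-; rewrite addKn.
exact: eq_card.
Qed.

(** The edge of the cycle missing from the tree; its Schreier generator is
    the label of the whole cycle, up to inversion. *)
Definition closing : nontree cycle_tree := Sub (edge ord_max) edge_max.

Variable pi : X -> {perm 'I_n}.
Hypothesis pi_cycle : forall k : 'I_n, pi (l k).1 (src k) = tgt k.

Definition cycle_basis := schreier pi (fun v => prefix v) (tree := cycle_tree).

Lemma act_letter (k : 'I_n) :
  fg_eval pi (letter_val (@fg_gen X) (l k)) k = ordS k.
Proof.
have := pi_cycle k; rewrite /src /tgt /letter_val; case: (l k).2 => e.
  by apply: (@perm_inj _ (pi (l k).1)); rewrite gmulfV /= fg_eval_gen permKV.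
by rewrite fg_eval_gen.
Qed.

Lemma act_prefix k (kn : k < n) : fg_eval pi (prefix k) ord0 = Ordinal kn.
Proof.
elim: k kn => [|k IH] kn; first by rewrite gmulf1 perm1; exact: val_inj.
rewrite /= gmulfM permM /= (IH (ltnW kn)).
rewrite -[l k]/(l (Ordinal (ltnW kn))) act_letter.
by apply: val_inj; rewrite /= modn_small.
Qed.

Lemma cocycle_prefix k : k < n -> cocycle pi cycle_tree ord0 (prefix k) = 1.
Proof.
elim: k => [|k IH] kn; first exact: cocycle1.
rewrite /= cocycleM IH ?(ltnW kn) // mul1g (act_prefix (ltnW kn)).
set v := Ordinal _; rewrite -[l k]/(l v).
have vt : edge v \in cycle_tree.
  by apply: imset_f; rewrite !inE -val_eqE /= neq_ltn -ltnS kn.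
have := act_letter v; move: vt; rewrite /edge /src /letter_val; case: (l v).2 => vt e.
  by rewrite cocycleV e cocycle_gen edge_label_tree // invg1.
by rewrite cocycle_gen edge_label_tree.
Qed.

Lemma prefix_tree v x : (v, x) \in cycle_tree ->
  prefix (pi x v) = prefix v * fg_gen x.
Proof.
case/imsetP => k; rewrite !inE -val_eqE /= => kn [-> ->]; rewrite pi_cycle.
have {}kn : k.+1 < n by rewrite /n ltnS ltn_neqAle kn -ltnS /= ltn_ord.
rewrite /src /tgt; case e : (l k).2; rewrite /= modn_small //= /letter_val e //.
by rewrite mulgVK.
Qed.

Theorem cycle_basisP : free_basis cycle_basis (stabilizer pi ord0).
Proof.
apply: schreier_basis => //.
- by move=> v; rewrite (act_prefix (ltn_ord v)); exact: val_inj.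
- by move=> v; exact: cocycle_prefix.
- exact: prefix_tree.
Qed.

Lemma finite_index_cycle : finite_index (stabilizer pi ord0).
Proof.
apply: (@finite_index_stabilizer _ _ pi ord0 (fun v : 'I_n => prefix v)) => v.
by rewrite (act_prefix (ltn_ord v)); exact: val_inj.
Qed.

Lemma cycle_basis_closing : cycle_basis closing =
  if (l m).2 then (prefix n)^-1 else prefix n.
Proof.
have := pi_cycle ord_max.
rewrite /cycle_basis /schreier /= => ->; rewrite /src /tgt /letter_val /=.
case: (l m).2; rewrite /= modnn /=; first by rewrite mul1g invgM invgK.
by rewrite invg1 mulg1.
Qed.

End Cycle.
Arguments cycle_basis {X m} l pi y : rename.

(** ** Reduction to cyclically reduced words *)

Section Words.
Variable X : choiceType.
Implicit Types (g : free_group X) (w : seq (letter X)).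

Definition word_val w : free_group X :=
  foldr (fun l g => letter_val (@fg_gen X) l * g) 1 w.

Lemma word_valK g : word_val (fg_word g) = g.
Proof. exact: fg_eval_id. Qed.

Lemma fg_word_val w : reduced w -> fg_word (word_val w) = w.
Proof. by move=> rw; rewrite -[in LHS]/(fg_word (FreeGroup rw)) word_valK. Qed.

Lemma word_val_cat w w' : word_val (w ++ w') = word_val w * word_val w'.
Proof. by elim: w => [|l w IH] /=; rewrite ?mul1g // IH mulgA. Qed.

Lemma cyclic_reduction g : g <> 1 -> exists c, exists x s,
  fg_word (g ^ c) = x :: s /\ x != linv (last x s).
Proof.
have [k] := ubnP (size (fg_word g)); elim: k g => // k IH g gk g1.
case ew : (fg_word g) (fg_reduced g) gk => [|x s] rw gk.
  by case: g1; rewrite -(word_valK g) ew.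
have [xs|] := boolP (x != linv (last x s)).
  by exists 1, x, s; rewrite conjg1.
rewrite negbK => /eqP; case/lastP: s rw gk ew => [|s y] rw gk ew.
  by move=> /(congr1 snd) /=; case: (x.2).
rewrite last_rcons => e; have ey : y = linv x by rewrite e linvK.
have rs : reduced s.
  by move: rw; rewrite /reduced -cats1 /= cat_path => /andP[/path_sorted].
have eg : g ^ letter_val (@fg_gen X) x = word_val s.
  rewrite -[in LHS](word_valK g) ew -cats1 /= word_val_cat /= mulg1 ey.
  by rewrite letter_valV conjgE -!mulgA mulKg mulVg mulg1.
have [|s1|c [z [u P]]] := IH (word_val s).
- rewrite fg_word_val //; move: gk; rewrite /= size_rcons ltnS.
  exact/leq_trans/ltnW.
- case: s rw {gk rs eg ew} s1 => [|z s] rw s1.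
    by move: rw; rewrite /= ey eqxx.
  have rs : reduced (z :: s).
    by move: rw; rewrite /reduced -cats1 /= cat_path => /andP[_ /andP[]].
  by have := fg_word_val rs; rewrite s1.
exists (letter_val (@fg_gen X) x * c), z, u.
by rewrite conjgM eg.
Qed.

End Words.

(** * Conjugating basis elements by commensurations *)

Lemma free_basis_reindex (X Y Y' : choiceType) (b : Y' -> free_group X)
    (H : set (free_group X)) (f : Y -> Y') :
  bijective f -> free_basis b H -> free_basis (b \o f) H.
Proof.
case=> f' fK f'K [bI bH bS].
pose r := fg_eval (@fg_gen Y' \o f); pose r' := fg_eval (@fg_gen Y \o f').
have comp u : fg_eval (b \o f) u = fg_eval b (r u).
  rewrite -[RHS]/((_ \o _) u) fg_eval_comp => [|x y]; last exact: gmulfM.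
  by congr (fg_eval _ u); apply/funext => y /=; rewrite fg_eval_gen.
have rK : cancel r r'.
  move=> u; rewrite -[LHS]/((_ \o _) u) fg_eval_comp => [|x y]; last exact: gmulfM.
  rewrite -[RHS]fg_eval_id; congr (fg_eval _ u); apply/funext => y /=.
  by rewrite /r' fg_eval_gen /= fK.
have r'K : cancel r' r.
  move=> u; rewrite -[LHS]/((_ \o _) u) fg_eval_comp => [|x y]; last exact: gmulfM.
  rewrite -[RHS]fg_eval_id; congr (fg_eval _ u); apply/funext => y /=.
  by rewrite /r fg_eval_gen /= f'K.
split=> [u v|u|h /bS[u <-]].
- by rewrite !comp => /bI/(can_inj rK).
- by rewrite comp.
- by exists (r' u); rewrite comp r'K.
Qed.

Lemma basis_commensuration (X Y : choiceType) (b b' : Y -> free_group X)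
    (H H' : set (free_group X)) :
  finite_index H -> finite_index H' -> free_basis b H -> free_basis b' H' ->
  exists2 a : comm_pair (free_group X), cp_dom a = H & forall y, a (b y) = b' y.
Proof.
move=> fH fH' [bI bH bS] [bI' bH' bS'].
pose f x := fg_eval b' (xget 1 [set u | fg_eval b u = x]).
have fE u : f (fg_eval b u) = fg_eval b' u.
  congr (fg_eval b' _); apply: xget_unique => // v; exact: bI.
have fM x y : H x -> H y -> f (x * y) = f x * f y.
  by move=> /bS[u <-] /bS[v <-]; rewrite -gmulfM !fE gmulfM.
have fI : set_inj H f.
  by move=> x y; rewrite !inE => /bS[u <-] /bS[v <-]; rewrite !fE => /bI'->.
have fim : finite_index (f @` H).
  suff -> : f @` H = H' by [].
  apply/seteqP; split=> [_ [x /bS[u <-] <-]|h /bS'[u <-]]; first by rewrite fE.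
  by exists (fg_eval b u); rewrite ?fE.
exists (CommPair fH fM fI fim) => // y /=.
by rewrite -(fg_eval_gen b y) fE fg_eval_gen.
Qed.

HB.instance Definition _ (G : groupType) :=
  Multiplicative_isUMagmaMorphism.Build G (Comm G) (@comm_conj G) erefl.

Section Conjugation.
Variable G : groupType.

(** The commensurator acts on [G] by conjugation as commensurations do. *)
Lemma comm_conj_act (a : comm_pair G) g : cp_dom a g ->
  comm_conj g ^ (\pi_(Comm G) a)^-1 = comm_conj (a g).
Proof.
move=> ag; rewrite conjgE invgK mulgA; apply: (@mulIg _ (\pi_(Comm G) a)).
rewrite mulgVK [LHS]comm_mul_pi [RHS]comm_mul_pi.
have sa := cp_subgroup a; have ag' := subgroupV sa ag.
apply/CommP/comm_equivP; exists (cp_dom a); split=> //.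
- exact: cp_dom_finite_index.
- by move=> x ax; split=> //=; do !apply: subgroupM => //.
- move=> x ax /=; rewrite !cp_morph //; last exact: subgroupM.
  by rewrite (locmorphV sa (@cp_morph _ a)).
Qed.

End Conjugation.

(** A bijection from [Y] to [Y'] that sends [y1] to [z1] and [y2] to [z2] gives
    a commensuration [a] from [H] to [H']. As [f] conjugates [b y1] to [b y2],
    the conjugate of [f] by [a], which lies in [M], conjugates [b' z1] to
    [b' z2]. *)
Lemma basis_conjugation (X Y Y' : finType) (M : set (Comm (free_group X)))
    (b : Y -> free_group X) (b' : Y' -> free_group X)
    (H H' : set (free_group X)) y1 y2 z1 z2 f :
  normal_in M setT -> M (comm_conj f) ->
  finite_index H -> finite_index H' -> free_basis b H -> free_basis b' H' ->
  #|Y| = #|Y'| -> y1 != y2 -> z1 != z2 -> b y2 = b y1 ^ f ->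
  exists2 m, M m & comm_conj (b' z2) = comm_conj (b' z1) ^ m.
Proof.
move=> [_ _ nM] Mf fH fH' bH bH' eY ny nz e.
have [||g gb gP] := @partial_bijection _ _ _ [set: bool]%SET
  (fun k : bool => if k then y1 else y2) (fun k => if k then z1 else z2) eY.
- by move=> [] [] _ _ // E; move: ny; rewrite E eqxx.
- by move=> [] [] _ _ // E; move: nz; rewrite E eqxx.
have := gP true (finset.in_setT _); have := gP false (finset.in_setT _) => /= g2 g1.
have [a ad aP] := basis_commensuration fH fH' bH (free_basis_reindex gb bH').
have bin y : cp_dom a (b y).
  by rewrite ad -(fg_eval_gen b y); case: bH => _ + _; exact.
exists (comm_conj f ^ (\pi_(Comm (free_group X)) a)^-1); first exact: nM.
have := aP y2; have := aP y1; rewrite /= g1 g2 => <- <-.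
rewrite -!comm_conj_act // -conjJg e.
by congr (_ ^ _); rewrite !conjgE !gmulfM gmulfV.
Qed.

(** In the covering used here [x_i] rotates the vertices and the other
    generators act trivially, so each of them gives a loop at every vertex:
    the loops at the vertices 0 and 1 yield [x_j] and its conjugate. *)
Lemma power_basis (X : finType) (i j : X) (m : nat) : i != j -> 0 < m ->
  exists (Y : finType) (b : Y -> free_group X) (H : set (free_group X)) y0 y1 z,
    [/\ finite_index H, free_basis b H & #|Y| = (m.+1 * #|X| - m)%N] /\
    [/\ y0 != y1, y0 != z, b y0 = fg_gen j, b y1 = fg_gen j ^ (fg_gen i)^-1
      & b z = fg_gen i ^+ m.+1].
Proof.
move=> ij m0; pose l (k : nat) : letter X := (i, false).
pose pi x : {perm 'I_m.+1} := if x == i then perm (@ordS_inj _) else 1.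
have per k : l (k + m.+1) = l k by [].
have red k : l k.+1 != linv (l k) by rewrite /l /linv; apply/eqP => -[].
have cyc (k : 'I_m.+1) : pi (l k).1 (src l k) = tgt l k.
  by rewrite /pi eqxx permE.
have edgeP (v : 'I_m.+1) : (v, j) \notin cycle_tree m l.
  by apply/imsetP => -[k _ [_ e]]; rewrite e eqxx in ij.
have prefixE k : prefix l k = fg_gen i ^+ k.
  by elim: k => //= k ->; rewrite expgSr.
pose y v : nontree (cycle_tree m l) := Sub (v, j) (edgeP v).
have bE v : cycle_basis l pi (y v) = fg_gen j ^ (fg_gen i ^+ v)^-1.
  rewrite /cycle_basis /schreier /= {1}/pi eq_sym (negbTE ij) perm1 prefixE.
  by rewrite conjgE invgK mulgA.
exists (nontree (cycle_tree m l)), (cycle_basis l pi), (stabilizer pi ord0).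
exists (y ord0), (y (Ordinal (m0 : 1 < m.+1))), (closing per red); split; split.
- exact: finite_index_cycle cyc.
- exact: cycle_basisP cyc.
- exact: card_nontree per red.
- by rewrite -val_eqE.
- by rewrite -val_eqE /= xpair_eqE /= [j == _]eq_sym (negbTE ij) andbF.
- by rewrite bE expg0 invg1 conjg1.
- by rewrite bE expg1.
- by rewrite (cycle_basis_closing per red cyc) /= prefixE -expgSr.
Qed.

(** Squaring ensures that the covering has degree at least 2, the case in
    which [power_basis] provides two conjugate members of a basis of the same
    size. *)
Lemma square_basis (X : finType) (g : free_group X) : g <> 1 ->
  exists (c : free_group X) (m : nat) (Y : finType) (b : Y -> free_group X)
    (H : set (free_group X)) y,
    [/\ 0 < m, finite_index H, free_basis b H & #|Y| = (m.+1 * #|X| - m)%N] /\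
    (b y = (g ^ c) ^+ 2 \/ b y = ((g ^ c) ^+ 2)^-1).
Proof.
case/cyclic_reduction => c [x [s [ew xs]]]; exists c.
set w := x :: s in ew; pose m := (size s + size w)%N.
pose l k := nth x w (k %% size w).
have rw : reduced w by rewrite -ew; exact: fg_reduced.
have per1 k : l (k + size w) = l k by rewrite /l modnDr.
have per k : l (k + m.+1) = l k by rewrite /m -addSn addnA !per1.
have red k : l k.+1 != linv (l k).
  rewrite /l; have := ltn_mod k (size w); rewrite /= -[k.+1]add1n -modnDmr.
  move: (k %% _) => r; rewrite ltnS leq_eqVlt => /orP[/eqP->|rs].
    by rewrite modnn /= -[nth _ _ _]/(nth x w (size w).-1) nth_last.
  by rewrite modn_small //; have /sortedP/(_ _ rs) := rw; exact.
have [pi cyc] := cycle_completion per red.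
exists m, (nontree (cycle_tree m l)), (cycle_basis l pi), (stabilizer pi ord0).
exists (closing per red); split.
  split; [exact: ltn_addl|exact: finite_index_cycle cyc
    |exact: cycle_basisP cyc|exact: card_nontree per red].
have prefix_word : prefix l (size w) = g ^ c.
  have h k : k <= size w -> prefix l k * word_val (drop k w) = g ^ c.
    elim: k => [|k IH] kw; first by rewrite mul1g drop0 -ew word_valK.
    rewrite -IH ?(ltnW kw) // [in RHS](drop_nth x) //= mulgA.
    by rewrite [l k]/(nth x w _) modn_small.
  by have := h _ (leqnn _); rewrite drop_size /= mulg1.
have prefixD k : prefix l (size w + k) = prefix l (size w) * prefix l k.
  elim: k => [|k IH]; first by rewrite addn0 mulg1.
  rewrite addnS -[LHS]/(prefix l (size w + k) * letter_val _ (l (size w + k))).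
  by rewrite IH addnC per1 mulgA.
have e2 : prefix l m.+1 = (g ^ c) ^+ 2.
  by rewrite -[m.+1]/(size w + size w)%N prefixD prefix_word.
by rewrite (cycle_basis_closing per red cyc) e2; case: ifP; [right|left].
Qed.

(** * Powers in subgroups of finite index *)

(** Two of the powers [g ^+ 0], ..., [g ^+ D] lie in the same coset. *)
Lemma finite_index_power (G : groupType) (H : set G) : finite_index H ->
  exists D, forall g, exists2 k, 0 < k <= D & H (g ^+ k).
Proof.
move=> fH; have [r _ rP] := finite_index_cover fH.
have sH : subgroup H by case: fH.
exists (size r) => g.
have /choice[u uP] : forall k : nat, exists t, t \in r /\ H (t^-1 * g ^+ k).
  by move=> k; have [t tr Ht] := rP (g ^+ k) I; exists t.
pose f (k : 'I_(size r).+1) := u k.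
have nf : ~~ injectiveb f.
  apply/negP => /injectiveP fi.
  have := uniq_leq_size (_ : uniq (map f (enum 'I_(size r).+1)))
    (_ : {subset map f (enum 'I_(size r).+1) <= r}).
  rewrite size_map -cardE card_ord ltnn => h.
  case: notF; apply: h; first by rewrite map_inj_uniq ?enum_uniq.
  by move=> _ /mapP[k _ ->]; case: (uP k).
case/injectivePn: nf => j [k nk e].
wlog jk : j k nk e / j < k.
  move=> h; have : val j != val k by [].
  rewrite neq_ltn => /orP[jk|kj]; first exact: (h j k).
  by apply: (h k j) => //; rewrite eq_sym.
exists (k - j)%N.
  rewrite subn_gt0 jk /= leq_subLR; apply: leq_trans (leq_addl _ _).
  by rewrite -ltnS.
have [_ Hj] := uP j; have [_ Hk] := uP k.
have := subgroupM sH (subgroupV sH Hj) Hk; rewrite [u j]e.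
rewrite invgM invgK mulgA mulgK.
by rewrite -[X in _ * g ^+ X](subnKC (ltnW jk)) expgnDr mulKg.
Qed.

(** * Normal subgroups of the commensurator *)

Section MainArgument.
Variables (X : finType) (i0 i1 : X).
Hypothesis i01 : i0 != i1.
Notation F := (free_group X).
Notation A := (Comm F).

Lemma other_gen (j : X) : exists i, i != j.
Proof.
by have [e|ne] := eqVneq i0 j; [exists i1; rewrite -e eq_sym|exists i0].
Qed.

Lemma subgroup_comm_conj (S : set A) : subgroup S -> subgroup (@comm_conj F @^-1` S).
Proof.
by move=> [S1 SD]; split=> [|x y Sx Sy] /=; rewrite ?gmulf1 ?gmulfF //; exact: SD.
Qed.

Section Normal.
Variable M : set A.
Hypothesis nM : normal_in M setT.
Hypothesis FM : forall f, M (comm_conj f).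

(** In the basis of [power_basis], [x_j] is conjugate in [F] to a second
    member; hence it is conjugate under [M] to the third, [x_i ^+ k]. *)
Lemma power_conj_gen (i j : X) k : i != j -> 1 < k ->
  exists2 m, M m & comm_conj (fg_gen j) = comm_conj (fg_gen i ^+ k) ^ m.
Proof.
case: k => // k ij k1.
have [Y [b [H [y0 [y1 [z [] [fH basH _] [n1 n2 e0 e1 ez]]]]]]] := power_basis ij k1.
rewrite -e0 -ez; rewrite eq_sym in n2.
apply: (basis_conjugation nM (FM (fg_gen i)^-1) fH fH basH basH erefl n1 n2).
by rewrite e1 e0.
Qed.

(** A nontrivial [a] moves some [g] of its domain, and the commutator of [a]
    with [g] is the nontrivial element [a g / g] of [F]. *)
Lemma normal_meets_free (S : set A) : normal_in S M -> S <> [set 1] ->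
  exists2 g : F, g <> 1 & S (comm_conj g).
Proof.
move=> [sS SM nS] S1.
have [a Sa a1] : exists2 a, S a & a <> 1.
  apply: contrapT => h; apply: S1; apply/seteqP; split=> [a Sa|_ ->].
    by apply: contrapT => a1; apply: h; exists a.
  exact: subgroup1.
pose p := repr a.
have ep : a = \pi_(Comm F) p by rewrite reprK.
have [g pg gg] : exists2 g, cp_dom p g & p g <> g.
  apply: contrapT => h; apply: a1; rewrite ep.
  apply/CommP/comm_equivP; exists (cp_dom p); split=> // [|x px].
    exact: cp_dom_finite_index.
  rewrite /= mul1g invg1 mulg1; apply: contrapT => px'; apply: h.
  by exists x.
exists (p g / g) => [/divg1_eq//|].
rewrite gmulfF /= -(comm_conj_act pg) -ep conjgE invgK -!mulgA.
apply: subgroupM => //.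
have := nS _ _ (subgroupV sS Sa) (FM g^-1).
by rewrite conjgE gmulfV /= invgK.
Qed.

(** Up to inversion, the square of a conjugate of [g] is in a basis [b] of
    some [H] of finite index; its conjugates under [M] include all of [b], so [S] contains [H]
    and a power of every generator. *)
Lemma normal_contains_free (S : set A) (g : F) : normal_in S M ->
  g <> 1 -> S (comm_conj g) -> forall f, S (comm_conj f).
Proof.
move=> nS g1 Sg.
have sS : subgroup S by case: nS.
have sSF := subgroup_comm_conj sS.
have gens i j : i != j -> (exists2 k, 1 < k & S (comm_conj (fg_gen i ^+ k))) ->
    S (comm_conj (fg_gen j)).
  move=> ij [k k1 Sk]; have [m Mm ->] := power_conj_gen ij k1.
  by case: nS => _ _; exact.
have [c [m [Y [b [H [z [] [m0 fH bH eY] bz]]]]]] := square_basis g1.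
have Sbz : S (comm_conj (b z)).
  have Sc : S (comm_conj ((g ^ c) ^+ 2)).
    rewrite expg2 gmulfM /=; have Sgc : S (comm_conj (g ^ c)).
      rewrite conjgE !gmulfM gmulfV /= -conjgE.
      by case: nS => _ _; apply => //; exact: FM.
    exact: subgroupM.
  case: bz => -> //; rewrite gmulfV /=; exact: subgroupV.
have [Y' [b' [H' [y0 [y1 [_ [] [fH' bH' eY'] [ny _ e0 e1 _]]]]]]] := power_basis i01 m0.
have Sb z' : S (comm_conj (b z')).
  have [->//|nz] := eqVneq z' z; rewrite eq_sym in nz.
  have ee : b' y1 = b' y0 ^ (fg_gen i0)^-1 by rewrite e0 e1.
  have eYY : #|Y'| = #|Y| by rewrite eY eY'.
  have [n Mn ->] := basis_conjugation nM (FM _) fH' fH bH' bH eYY ny nz ee.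
  by case: nS => _ _; exact.
have HS h : H h -> S (comm_conj h).
  case: bH => _ _ bS /bS[u <-].
  exact: (fg_eval_in sSF Sb u).
have [D DP] := finite_index_power fH.
move=> f; rewrite -(fg_eval_id f); apply: (fg_eval_in sSF) => j /=.
have [i ij] := other_gen j; apply: (gens i j ij).
have [k /andP[k0 _] Hk] := DP (fg_gen i ^+ 2).
(* The exponent must be at least 2 for the conjugacy of [gens]. *)
exists (2 * k)%N; last by rewrite expgnA; exact: HS.
by rewrite (leq_trans _ (leq_pmulr _ k0)).
Qed.

Lemma nontrivial_normal_contains_free (S : set A) :
  normal_in S M -> S <> [set 1] -> forall f, S (comm_conj f).
Proof.
by move=> nS /(normal_meets_free nS)[g g1 Sg]; exact: normal_contains_free Sg.
Qed.

End Normal.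

Lemma normalT : normal_in [set: A] setT.
Proof. by []. Qed.

Lemma gen_power_free k : 0 < k ->
  fg_gen i0 * fg_gen i1 ^+ k <> fg_gen i1 ^+ k * fg_gen i0.
Proof.
case: k => // k _ e.
have n1 : (i1, false) != linv (i0, false) by apply/eqP => -[].
have n2 : (i0, false) != linv (i1, false) by apply/eqP => -[].
have n3 : (i1, false) != linv (i1, false) by apply/eqP => -[].
have pw n : fg_word (fg_gen i1 ^+ n) = nseq n (i1, false).
  elim: n => // n IH; rewrite expgS.
  rewrite -[LHS]/(rcons_word (i1, false) (fg_word (fg_gen i1 ^+ n))) IH.
  by case: n {IH} => //= n; rewrite (negbTE n3).
have pw' n : fg_word (fg_gen i1 ^+ n * fg_gen i0) =
    rcons (nseq n (i1, false)) (i0, false).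
  elim: n => [|n IH]; first by rewrite mul1g.
  rewrite expgS -mulgA.
  rewrite -[LHS]/(rcons_word (i1, false) (fg_word (fg_gen i1 ^+ n * fg_gen i0))) IH.
  by case: n {IH} => [|n] /=; rewrite ?(negbTE n3) ?(negbTE n2).
have := congr1 (fun u : F => head (i1, false) (fg_word u)) e; rewrite pw'.
rewrite -[fg_word _]/(rcons_word (i0, false) (fg_word (fg_gen i1 ^+ k.+1))) pw.
rewrite /= (negbTE n1) => -[e01].
by move: i01; rewrite e01 eqxx.
Qed.

(** Otherwise the trivial subgroup of [A] would contain a nontrivial element
    of [F], hence all of [F]; but [x_0] does not commute with any positive
    power of [x_1]. *)
Lemma comm_conj_injective : injective (@comm_conj F).
Proof.
apply: gmulf_inj => g gK; apply: contrapT => g1.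
have nS : normal_in [set (1 : A)] setT.
  by split=> // [|_ h -> _]; [split=> // _ _ -> ->; rewrite /= divg1|rewrite /= conj1g].
have := normal_contains_free normalT (fun _ => I) nS g1 gK (fg_gen i0).
move/CommP/comm_equivP => [K [fK _ _ KP]].
have [D DP] := finite_index_power fK; have [k /andP[k0 _] Kk] := DP (fg_gen i1).
have := KP _ Kk; rewrite /= mul1g invg1 mulg1 => e.
by apply: (gen_power_free k0); rewrite -[in RHS]e mulgVK.
Qed.

Notation Mon := (monolith A).

Lemma normal_monolith : normal_in Mon setT.
Proof.
split=> //; first split.
- by move=> N [[sN _ _] _]; exact: subgroup1.
- move=> x y Mx My N hN; case: (hN) => -[sN _ _] _.
  by apply: (proj2 sN); [exact: Mx|exact: My].
- by move=> n h Mn _ N hN; case: (hN) => -[_ _ nN] _; apply: nN => //; exact: Mn.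
Qed.

Lemma monolith_contains_free f : Mon (comm_conj f).
Proof.
by move=> N [nN N1]; exact: nontrivial_normal_contains_free normalT _ _ nN N1 f.
Qed.

Lemma gen_noncommuting : ~ commute (comm_conj (fg_gen i0)) (comm_conj (fg_gen i1)).
Proof.
rewrite /commute -!gmulfM => /comm_conj_injective.
by have := @gen_power_free 1 isT; rewrite expg1.
Qed.

Lemma contains_free_neq1 (S : set A) : (forall f, S (comm_conj f)) -> S <> [set 1].
Proof.
move=> FS S1; apply: gen_noncommuting.
have : S (comm_conj (fg_gen i0)) by [].
rewrite S1 => ->; exact: commute_sym (commute1 _).
Qed.

Theorem almost_simple_Comm : almost_simple A.
Proof.
split.
- exact: contains_free_neq1 monolith_contains_free.
- split; first by case: normal_monolith.
    exact: contains_free_neq1 monolith_contains_free.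
  move=> N nN; have [->|N1] := pselect (N = [set 1]); [by left|right].
  case: (nN) => sN NM nNM; apply/seteqP; split=> // x Mx.
  (* The intersection of the conjugates of [N] in [A]. *)
  pose core : set A := [set y | forall a, N (y ^ a)].
  suff: core x by move=> /(_ 1); rewrite conjg1.
  apply: Mx; split; last first.
    apply: contains_free_neq1 => f a.
    pose Na : set A := [set y | N (y ^ a)].
    have nNa : normal_in Na Mon.
      split; first split.
      - by rewrite /Na /= conj1g; exact: subgroup1.
      - move=> y z Ny Nz; rewrite /Na /= conjMg conjVg.
        by apply: (proj2 sN).
      - move=> y /NM My; rewrite -(conjgK a y).
        by case: normal_monolith => _ _; apply.
      - move=> y h Ny Mh; rewrite /Na /= conjJg; apply: nNM => //.
        by case: normal_monolith => _ _; apply.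
    suff: Na (comm_conj f) by [].
    apply: (nontrivial_normal_contains_free normal_monolith monolith_contains_free nNa).
    move=> Na1; apply: N1; apply/seteqP; split=> [y Ny|_ ->]; last exact: subgroup1.
    have : Na (y ^ a^-1) by rewrite /Na /= conjgKV.
    by rewrite Na1 /= => /eqP; rewrite conjg_eq1 => /eqP.
  split=> //; first split.
  - by move=> a; rewrite conj1g; exact: subgroup1.
  - move=> y z Ny Nz a; rewrite conjMg conjVg; exact: (proj2 sN).
  - by move=> y h Ny _ a; rewrite -conjgM.
- by move/(_ _ _ (monolith_contains_free _) (monolith_contains_free _))/gen_noncommuting.
Qed.

(** * Infinite generation *)

Section Prime.
Variable p : nat.

(** The elements whose conjugation maps into [F], for each cyclic subgroup of
    [F], a subgroup of it of index prime to [p]. *)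
Definition prime_to_p (a : A) : Prop :=
  forall x : F, exists2 N, ~~ (p %| N)%N
    & exists z, comm_conj (x ^+ N) ^ a = comm_conj z.

Definition prime_to_p_group : set A :=
  [set a | prime_to_p a /\ prime_to_p a^-1].

Lemma prime_to_pM a b : prime p -> prime_to_p a -> prime_to_p b -> prime_to_p (a * b).
Proof.
move=> pp ha hb x; have [N pN [z ez]] := ha x; have [N' pN' [z' ez']] := hb z.
exists (N * N')%N; first by rewrite Euclid_dvdM // negb_or pN.
exists z'; rewrite expgnA conjgM gmulfXn /= conjXg ez -ez'.
by rewrite gmulfXn.
Qed.

Lemma subgroup_prime_to_p : prime p -> subgroup prime_to_p_group.
Proof.
move=> pp; split=> [|a b [a1 a2] [b1 b2]].
  have h : prime_to_p 1.
    move=> x; exists 1%N; first by rewrite Euclid_dvd1.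
    by exists (x ^+ 1); rewrite conjg1.
  by split; rewrite ?invg1.
by split; rewrite ?invgM ?invgK; exact: prime_to_pM.
Qed.

(** Map [x_j] to 1 and the other generators to 0 in the integers modulo [p]. *)
Lemma gen_power_dvd (j : X) N (z : F) : prime p ->
  z ^+ p = fg_gen j ^+ N -> (p %| N)%N.
Proof.
move=> pp e; pose f (x : X) : 'I_p.-1.+1 := if x == j then inZp 1 else 1.
have := congr1 (fg_eval f) e; rewrite !gmulfXn /= fg_eval_gen /f eqxx -/f.
have p0 := prime_gt0 pp.
rewrite !Zp_expg => /(congr1 val) /=; move: (_ z) => k.
by rewrite modnMml mul1n; move: (val k) => {}k; rewrite prednK // modnMl => /esym/eqP.
Qed.
End Prime.

Lemma prime_to_p_large (a : A) : exists D, forall p, D < p -> prime_to_p p a.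
Proof.
pose b := repr a^-1.
have eb : a^-1 = \pi_(Comm F) b by rewrite reprK.
have [D DP] := finite_index_power (cp_dom_finite_index b).
exists D => p Dp x; have [k /andP[k0 kD] bk] := DP x.
exists k; first by rewrite gtnNdvd // (leq_ltn_trans kD).
by exists (b (x ^+ k)); rewrite -(comm_conj_act bk) -eb invgK.
Qed.

Theorem monolith_not_fg : ~ finitely_generated Mon.
Proof.
case=> S /finite_seqP[s ->] eM.
have [D DP] : exists D, forall p, D < p -> forall a, a \in s -> prime_to_p_group p a.
  elim: s {eM} => [|a s [D DP]]; first by exists 0%N.
  have [Da DaP] := prime_to_p_large a; have [Db DbP] := prime_to_p_large a^-1.
  exists (D + Da + Db)%N => p lt b; rewrite inE => /orP[/eqP->|bs].
    by split; [apply: DaP|apply: DbP]; apply: leq_ltn_trans lt;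
      rewrite ?leq_addl // -addnA addnCA leq_addr.
  by apply: DP => //; apply: leq_ltn_trans lt; rewrite -addnA leq_addr.
have [p Dp pp] := prime_above D.
have MP a : Mon a -> prime_to_p_group p a.
  rewrite eM; apply; split; first exact: subgroup_prime_to_p.
  by move=> b /= bs; exact: DP.
have [m /MP[mP _] e] :=
  power_conj_gen normal_monolith monolith_contains_free i01 (prime_gt1 pp).
have [N pN [z ez]] := mP (fg_gen i0).
case/negP: pN; apply: (@gen_power_dvd _ i1 N z pp); apply: comm_conj_injective.
rewrite gmulfXn /= -ez -conjXg -gmulfXn -expgnA mulnC expgnA.
by rewrite [in LHS]gmulfXn /= conjXg -e -gmulfXn.
Qed.

End MainArgument.

Theorem theoremA2 (d : nat) (hd : (2 <= d)%N) :
  [/\ almost_simple (Comm (free_group 'I_d)),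
      exists2 H : set (free_group 'I_d), finite_index H
        & [set comm_conj h | h in H] `<=` monolith (Comm (free_group 'I_d))
    & ~ finitely_generated (monolith (Comm (free_group 'I_d)))].
Proof.
have i01 : Ordinal (ltnW hd) != Ordinal hd by [].
split; [exact: almost_simple_Comm i01| |exact: monolith_not_fg i01].
exists setT; first exact: finite_indexT.
by move=> _ [h _ <-]; exact: monolith_contains_free i01 h.
Qed.
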